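(* Let $k\ge 1$ and let $\mathcal{D}'$ be the space of holomorphic maps $f:\mathbb{C}^k\to\mathbb{C}$ satisfying $f(z,\ldots,z)=z$ for all $z\in\mathbb{C}$. The set of periodic points for the translation flow on $\mathcal{D}'$ is dense in $\mathcal{D}'$.
   Context: $\mathcal{D}'$ carries the compact-open topology (uniform convergence on compact sets). The translation flow on $\mathcal{D}'$ is the action of $\mathbb{R}$ given by $(f,t)\mapsto f_t$, where $f_t(z_1,\ldots,z_k)=f(z_1-t,\ldots,z_k-t)+t$. A point $f\in\mathcal{D}'$ is periodic if $f_T=f$ for some $T>0$. *)

(* Defs.v *)
From HB Require Import structures.
From mathcomp Require Import all_boot all_order all_algebra.
From mathcomp Require Import all_classical all_reals all_analysis.
From mathcomp Require Import complex.

Set Implicit Arguments.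
Unset Strict Implicit.
Unset Printing Implicit Defensive.

Import Order.TTheory GRing.Theory Num.Theory.
Import numFieldNormedType.Exports.

Local Open Scope classical_set_scope.
Local Open Scope ring_scope.
Local Open Scope complex_scope.

(* The usual topology and norm of C = R[i], as a normed module over itself;
   without this instance only the alias R[i]^o carries them. *)
#[warnings="-redundant-canonical-projection"]
HB.instance Definition _ (R : realType) := NormedModule.copy R[i] R[i]^o.

Section TranslationFlow.
Variables (R : realType) (k : nat).
Local Notation C := R[i].

(* [differentiable] is Frechet differentiability with a continuous linear
   differential over the scalar field of the modules, here C. *)
Definition holomorphic (f : 'rV[C]_k -> C) : Prop :=
  forall z : 'rV[C]_k, differentiable f z.

Definition diag_holo_set : set {compact-open, 'rV[C]_k -> C} :=
  [set f | holomorphic f /\ forall z : C, f (const_mx z) = z].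

(* The topology on the subtype is induced by the compact-open topology. *)
Definition diag_holo : topologicalType := set_type diag_holo_set.

Definition translate (f : 'rV[C]_k -> C) (t : R) : 'rV[C]_k -> C :=
  fun z => f (z - const_mx t%:C) + t%:C.

Lemma translate_diag_holo (f : diag_holo) (t : R) :
  translate (set_val f) t \in diag_holo_set.
Proof.
have [hf df] : diag_holo_set (set_val f) by exact: set_valP.
rewrite inE; split => z; last first.
  rewrite /translate.
  have -> : const_mx z - const_mx t%:C = const_mx (z - t%:C) :> 'rV[C]_k.
    by apply/rowP => i; rewrite !mxE.
  by rewrite df subrK.
rewrite /translate.
apply: differentiableD; last exact: differentiable_cst.
apply: (@differentiable_comp _ _ _ _ (fun z => z - const_mx t%:C) (set_val f)).
  by apply: differentiableD => //; exact: differentiable_cst.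
exact: hf.
Qed.

Definition translation_flow (f : diag_holo) (t : R) : diag_holo :=
  SigSub (translate_diag_holo f t).

Definition periodic_point (f : diag_holo) : Prop :=
  exists2 T : R, 0 < T & translation_flow f T = f.

End TranslationFlow.

(* Main.v *)
(* Write f_T(z) = z_0 + f(s_T(z_1), ..., s_T(z_k)) - s_T(z_0), where z_0 is any
   fixed coordinate of z and s_T(w) = (T / (2 pi i)) (exp(2 pi i w / T) - 1).
   The entire function s_T is T-periodic, so f_T is again holomorphic, is the
   identity on the diagonal and is fixed by the time-T map of the flow.  As
   T -> +oo, s_T converges to the identity locally uniformly, because exp has
   derivative 1 at 0; hence f_T converges to f uniformly on compact sets. *)
Require Import Defs.
From mathcomp Require Import all_boot all_order all_algebra.
From mathcomp Require Import all_classical all_reals all_analysis.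
From mathcomp Require Import complex ring lra.

Set Implicit Arguments.
Unset Strict Implicit.
Unset Printing Implicit Defensive.

Import Order.TTheory GRing.Theory Num.Theory.
Import numFieldNormedType.Exports.

Local Open Scope classical_set_scope.
Local Open Scope ring_scope.
Local Open Scope complex_scope.

(** The little-o of the first-order expansion at 0 with its constant made explicit, so that the
    bounds for exp, sin and cos can be combined arithmetically. *)
Lemma is_derive0_near (R : realType) (f : R -> R) (d e : R) :
  is_derive (0 : R) (1 : R) f d -> 0 < e ->
  \forall x \near (0 : R), `|f x - f 0 - d * x| <= e * `|x|.
Proof.
move=> [df dE] e0.
have /diff_locally /eqaddoP /(_ e e0) : differentiable f (0 : R).
  exact/derivable1_diffP.
apply: filterS => x.
rewrite deriv1E // derive1E dE /= !fctE /= addr0 opprD addrA => H.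
by rewrite (mulrC d).
Qed.

(** * The complex exponential and its first-order behaviour at 0 *)

Section ComplexExp.
Variable R : realType.
Local Notation C := R[i].
Local Notation Re := complex.Re.
Local Notation Im := complex.Im.

Definition cexp (z : C) : C :=
  (expR (Re z) * cos (Im z)) +i* (expR (Re z) * sin (Im z)).

Lemma cexpD (z w : C) : cexp (z + w) = cexp z * cexp w.
Proof.
case: z w => [a b] [c d]; rewrite /cexp /=.
by apply/eqP; rewrite eq_complex /= expRD cosD sinD; apply/andP; split; apply/eqP; ring.
Qed.

Lemma cexp2pi : cexp (0 +i* (pi *+ 2)) = 1.
Proof. by rewrite /cexp /= expR0 cos2pi sin2pi mulr0 mulr1. Qed.

Lemma ler_normc_ReIm (z : C) : `|z| <= (`|Re z| + `|Im z|)%:C.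
Proof.
rewrite [in leLHS](complexE z) rmorphD /=.
apply: (le_trans (ler_normD _ _)); rewrite normrM.
have normC (a : R) : `|a%:C| = `|a|%:C.
  by rewrite normc_def /= expr0n /= addr0 sqrtr_sqr.
have -> : `|'i%C : C| = 1 by rewrite normc_def /= expr0n /= add0r expr1n sqrtr1.
by rewrite mul1r !normC.
Qed.

Lemma normc_ge_Im (z : C) : `|Im z|%:C <= `|z|.
Proof.
have := normc_ge_Re (z * 'i); rewrite ReiNIm normrN normrM.
by rewrite [`|'i%C|]normc_def /= expr0n /= add0r expr1n sqrtr1 mulr1.
Qed.

(** Both coordinates are bounded by the modulus, so a real neighbourhood of 0 controls each of them
    on a complex disc of the same radius. *)
Lemma near0_ReIm (P : R -> Prop) :
  (\forall x \near (0 : R), P x) ->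
  \forall z \near (0 : C), P (Re z) /\ P (Im z).
Proof.
move=> /nbhs_ballP [e /= e0 He].
apply/nbhs_ballP; exists e%:C => /=; first by rewrite ltcR.
move=> z; rewrite -ball_normE /= sub0r normrN => ze.
split; apply: He; rewrite -ball_normE /= sub0r normrN -ltcR.
  exact: le_lt_trans (normc_ge_Re z) ze.
exact: le_lt_trans (normc_ge_Im z) ze.
Qed.

(** With z = x + iy, the two parts are e^x cos y - 1 - x and e^x sin y - y, which the real
    expansions of exp, sin and cos control. The bound yields both the derivative of [cexp] and the
    convergence of [pexp]. *)
Lemma cexp_sub1_near0 (e : R) : 0 < e ->
  \forall z \near (0 : C), `|cexp z - 1 - z| <= e%:C * `|z|.
Proof.
(* The two parts add up to at most 6d(|x| + |y|) <= 12d|z|, hence e / 12; the cap 1 gives |e^x - 1|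
   <= 2|x| and e^x <= 3. *)
move=> e0; pose d := Num.min 1 (e / 12).
have d0 : 0 < d by rewrite lt_min ltr01 divr_gt0.
have dexp := is_derive0_near (is_derive_expR 0) d0.
have dsin := is_derive0_near (is_derive_sin 0) d0.
have dcos := is_derive0_near (is_derive_cos 0) d0.
have dlt := @nbhs0_lt _ R _ d0.
apply: filterS (near0_ReIm (filterI dlt (filterI dexp (filterI dsin dcos)))).
move=> z [[x1 [x2 _]] [y1 [_ [y2 y3]]]].
have d1 : d <= 1 by rewrite ge_min lexx.
have d12 : d <= e / 12 by rewrite ge_min lexx orbT.
have {}d12 : 12 * d <= e by rewrite mulrC -ler_pdivlMr.
apply: (le_trans (ler_normc_ReIm _)).
case: z x1 x2 y1 y2 y3 => x y /=.
rewrite expR0 sin0 cos0 !oppr0 mul0r subr0 !addr0 !mul1r => x1 x2 y1 y2 y3.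
have xz : `|x|%:C <= `|x +i* y| by exact: (normc_ge_Re (x +i* y)).
have yz : `|y|%:C <= `|x +i* y| by exact: (normc_ge_Im (x +i* y)).
have [x0 y0] : 0 <= `|x| /\ 0 <= `|y| by [].
have E2 : `|expR x - 1| <= 2 * `|x|.
  have -> : expR x - 1 = (expR x - 1 - x) + x by ring.
  apply: (le_trans (ler_normD _ _)); nra.
have E3 : `|expR x| <= 3.
  have -> : expR x = (expR x - 1) + 1 by ring.
  apply: (le_trans (ler_normD _ _)); rewrite normr1; nra.
have B1 : `|expR x * cos y - 1 - x| <= 3 * d * `|y| + d * `|x|.
  have -> : expR x * cos y - 1 - x = expR x * (cos y - 1) + (expR x - 1 - x).
    by ring.
  apply: (le_trans (ler_normD _ _)); apply: lerD => //.
  rewrite normrM -mulrA; exact: ler_pM.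
have B2 : `|expR x * sin y - y| <= 3 * d * `|y| + 2 * d * `|x|.
  have -> : expR x * sin y - y = expR x * (sin y - y) + y * (expR x - 1).
    by ring.
  apply: (le_trans (ler_normD _ _)); apply: lerD.
    rewrite normrM -mulrA; exact: ler_pM.
  by rewrite normrM (mulrC 2) -mulrA; apply: ler_pM => //; exact: ltW.
apply: (@le_trans _ _ (6 * d * (`|x| + `|y|))%:C).
  rewrite lecR.
  have := mulr_ge0 (ltW d0) x0; have := mulr_ge0 (ltW d0) y0; nra.
have : (`|x| + `|y|)%:C <= 2%:C * `|x +i* y|.
  by rewrite rmorphD [2%:C]rmorphD /= mulrDl mul1r lerD.
rewrite normc_def -!rmorphM /= !lecR; set n := Num.sqrt _ => xyn.
have n0 : 0 <= n by exact: sqrtr_ge0.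
clear -xyn n0 d12 d0; nra.
Qed.

Lemma cexp_derive0 : (fun h : C => h^-1 * (cexp h - 1)) @ 0^' --> (1 : C).
Proof.
apply/cvgrPdist_le => e e0.
(* A positive element for the partial order of [C] is real, so the real-epsilon estimate applies. *)
have eE : e = (Re e)%:C by rewrite RRe_real // gtr0_real.
have /cexp_sub1_near0 H : 0 < Re e by rewrite -ltcR -eE.
near=> h.
have h0 : h != 0 by near: h; exact: nbhs_dnbhs_neq.
have -> : 1 - h^-1 * (cexp h - 1) = - (h^-1 * (cexp h - 1 - h)).
  by rewrite (mulrBr _ _ h) mulVf // opprB.
rewrite normrN normrM normfV mulrC ler_pdivrMr ?normr_gt0 // eE.
near: h; exact: nbhs_dnbhs.
Unshelve. all: by end_near. Qed.

(** By the functional equation, the difference quotient at z is [cexp z] times the one at 0. *)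
Lemma differentiable_cexp (z : C) : differentiable (cexp : C -> C) z.
Proof.
apply/derivable1_diffP; apply/cvg_ex; exists (cexp z).
have -> : (fun h : C => h^-1 *: ((cexp \o shift z) (h *: 1) - cexp z))
  = (fun h => cexp z * (h^-1 * (cexp h - 1))).
  apply/funext => h /=; rewrite /GRing.scale /= mulr1 cexpD; ring.
rewrite -[X in _ --> X]mulr1; apply: cvgM; first exact: cvg_cst.
exact: cexp_derive0.
Qed.

(** * The periodic maps s_T and their convergence to the identity *)

Definition freq (T : R) : C := 0 +i* (pi *+ 2 / T).

(* This is s_T above. *)
Definition pexp (T : R) (w : C) : C := (freq T)^-1 * (cexp (freq T * w) - 1).

Lemma freqM (T : R) : T != 0 -> freq T * T%:C = 0 +i* (pi *+ 2).
Proof.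
by move=> T0; apply/eqP; rewrite eq_complex /= !mul0r mulr0 oppr0 !add0r divfK // !eqxx.
Qed.

Lemma norm_freq (T : R) : 0 < T -> `|freq T| = (pi *+ 2 / T)%:C.
Proof.
move=> T0; rewrite normc_def /= expr0n /= add0r sqrtr_sqr ger0_norm //.
by apply: divr_ge0; [exact: mulrn_wge0 (pi_ge0 R)|exact: ltW].
Qed.

Lemma freq_neq0 (T : R) : 0 < T -> freq T != 0.
Proof.
move=> T0; rewrite -normr_gt0 norm_freq // ltcR.
by rewrite divr_gt0 // mulrn_wgt0 ?pi_gt0.
Qed.

Lemma pexp_periodic (T : R) (w : C) : T != 0 -> pexp T (w - T%:C) = pexp T w.
Proof.
move=> T0; congr (_ * (_ - _)).
have -> : freq T * w = freq T * (w - T%:C) + freq T * T%:C by ring.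
by rewrite cexpD freqM // cexp2pi mulr1.
Qed.

Lemma differentiable_pexp (T : R) (w : C) : differentiable (pexp T : C -> C) w.
Proof.
apply: differentiableM => //; apply: differentiableD => //.
apply: (@differentiable_comp _ _ _ _ (fun w : C => freq T * w) cexp).
  exact: differentiableM.
exact: differentiable_cexp.
Qed.

Lemma freq_cvg0 : freq T @[T --> +oo%R] --> (0 : C).
Proof.
apply/cvgrPdist_lt => e e0.
have eE : e = (Re e)%:C by rewrite RRe_real // gtr0_real.
have e0' : 0 < Re e by rewrite -ltcR -eE.
near=> T.
have T0 : 0 < T by near: T; apply: nbhs_pinfty_gt; exact: num_real.
rewrite sub0r normrN norm_freq // eE ltcR ltr_pdivrMr //.
rewrite mulrC -ltr_pdivrMr //.
near: T; apply: nbhs_pinfty_gt; exact: num_real.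
Unshelve. all: by end_near. Qed.

(** The limit is joint in the point and T: this encodes locally uniform convergence in the form used
    for compact sets below. *)
Lemma pexp_cvg (w : C) :
  pexp p.2 p.1 @[p --> (w, +oo%R)] --> w.
Proof.
have T_cvg : p.2 @[p --> (w, +oo%R : set_system R)] --> +oo%R.
  exact: cvg_snd.
have aw_cvg : freq p.2 * p.1 @[p --> (w, +oo%R)] --> (0 : C).
  rewrite -[X in _ --> X](mul0r w); apply: cvgM; last exact: cvg_fst.
  by apply: cvg_comp freq_cvg0; exact: cvg_snd.
have w_cvg : p.1 @[p --> (w, +oo%R : set_system R)] --> w by exact: cvg_fst.
apply/cvgrPdist_le => e e0.
have M0 : 0 < `|w| + 1 by rewrite ltr_wpDl.
(* The Taylor remainder, divided by [freq p.2], is at most d|p.1|, which is below e / 2 once |p.1| <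
   |w| + 1; the other half of e bounds |w - p.1|. *)
pose d : C := e / 2 / (`|w| + 1).
have d0 : 0 < d by rewrite !divr_gt0.
have dE : d = (Re d)%:C by rewrite RRe_real // gtr0_real.
have /cexp_sub1_near0 H : 0 < Re d by rewrite -ltcR -dE.
near=> p.
have T0 : 0 < p.2.
  near: p; exact: T_cvg _ (nbhs_pinfty_gt (num_real 0)).
have -> : w - pexp p.2 p.1 = (w - p.1) - (freq p.2)^-1 *
    (cexp (freq p.2 * p.1) - 1 - freq p.2 * p.1).
  by rewrite (mulrBr _ _ (freq p.2 * p.1)) mulKf ?freq_neq0 // /pexp; ring.
rewrite [e]splitr; apply: (le_trans (ler_normB _ _)); apply: lerD.
  near: p; apply: cvgr_dist_le w_cvg _ _; by rewrite divr_gt0.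
rewrite normrM normfV mulrC ler_pdivrMr ?normr_gt0 ?freq_neq0 //.
apply: (@le_trans _ _ (d * `|freq p.2 * p.1|)).
  rewrite dE; near: p; exact: aw_cvg H.
rewrite normrM (mulrC `|freq _|) mulrA ler_wpM2r //.
rewrite /d mulrAC ler_pdivrMr // ler_wpM2l ?divr_ge0 // ?ltW //.
rewrite -ltrBlDl (le_lt_trans (lerB_dist _ _)) // distrC.
near: p; exact: cvgr_dist_lt w_cvg _ _.
Unshelve. all: by end_near. Qed.

End ComplexExp.

(** * Periodization of maps on C^k and its convergence *)

Section Periodization.
Variables (R : realType) (k : nat).
Local Notation C := R[i].

Lemma coord_cvg (z : 'rV[C]_k) i j :
  (p.1 : 'rV[C]_k) i j @[p --> (z, +oo%R : set_system R)] --> z i j.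
Proof.
apply: (@cvg_comp _ _ _ fst (fun M : 'rV[C]_k => M i j) _ (nbhs z)).
  exact: cvg_fst.
exact: coord_continuous.
Qed.

Lemma pexp_coord_cvg (z : 'rV[C]_k) i j :
  pexp p.2 ((p.1 : 'rV[C]_k) i j) @[p --> (z, +oo%R : set_system R)] --> z i j.
Proof.
have coord : ((p.1 : 'rV[C]_k) i j, p.2) @[p --> (z, +oo%R : set_system R)] -->
    (z i j, +oo%R : set_system R).
  exact: cvg_pair (@coord_cvg z i j) cvg_snd.
exact: cvg_comp _ _ coord (@pexp_cvg R (z i j)).
Qed.

Lemma pexp_mx_cvg (z : 'rV[C]_k) :
  map_mx (pexp p.2) p.1 @[p --> (z, +oo%R : set_system R)] --> z.
Proof.
apply/cvg_ballP => e e0.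
near=> p; split => // i j; rewrite mxE.
move: i j; near: p; apply: filter_forall => i; apply: filter_forall => j.
by have /cvg_ballP /(_ e e0) := @pexp_coord_cvg z i j.
Unshelve. all: by end_near. Qed.

(** Expanding in the standard basis reduces the claim to the one-variable map composed with
    coordinates. *)
Lemma differentiable_pexp_mx (T : R) (z : 'rV[C]_k) :
  differentiable (map_mx (pexp T) : 'rV[C]_k -> 'rV[C]_k) z.
Proof.
have -> : (map_mx (pexp T) : 'rV[C]_k -> 'rV[C]_k) =
    \sum_(j < k) (fun M : 'rV[C]_k => pexp T (M ord0 j) *: delta_mx ord0 j).
  apply/funext => M; rewrite fct_sumE; apply/rowP => i.
  rewrite summxE (bigD1 i) //= big1 => [|j ji]; rewrite !mxE ?eqxx.
    by rewrite addr0 mulr1.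
  by rewrite eq_sym (negbTE ji) mulr0.
apply: differentiable_sum => j; apply: differentiableZl.
apply: (@differentiable_comp _ _ _ _ (fun M : 'rV[C]_k => M ord0 j) (@pexp R T)).
  exact: differentiable_coord.
exact: differentiable_pexp.
Qed.

Variables (i0 : 'I_k) (f : 'rV[C]_k -> C).

(** This is f_T, with [i0] the chosen coordinate. *)
Definition periodize (T : R) (z : 'rV[C]_k) : C :=
  z ord0 i0 + f (map_mx (pexp T) z) - pexp T (z ord0 i0).

Lemma periodize_diag_holo (T : R) :
  diag_holo_set f -> periodize T \in @diag_holo_set R k.
Proof.
move=> [hf df]; rewrite inE; split => z; last first.
  by rewrite /periodize map_const_mx df mxE addrK.
apply: differentiableB; last first.
  apply: (@differentiable_comp _ _ _ _ (fun M : 'rV[C]_k => M ord0 i0) (@pexp R T)).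
    exact: differentiable_coord.
  exact: differentiable_pexp.
apply: differentiableD; first exact: differentiable_coord.
apply: (@differentiable_comp _ _ _ _ (map_mx (pexp T)) f).
  exact: differentiable_pexp_mx.
exact: hf.
Qed.

(** Only the bare coordinate feels the shift: it loses T, which the flow adds back. *)
Lemma translate_periodize (T : R) : T != 0 ->
  translate (periodize T) T = periodize T.
Proof.
move=> T0; apply/funext => z; rewrite /translate /periodize.
have -> : map_mx (pexp T) (z - const_mx T%:C) = map_mx (pexp T) z.
  by apply/rowP => i; rewrite !mxE pexp_periodic.
rewrite !mxE pexp_periodic //; ring.
Qed.

Lemma periodize_cvg : continuous f ->
  {compact-open, periodize T @[T --> +oo%R] --> f}.
Proof.
move=> cf; apply/compact_open_cvgP => K O cK oO fKO.
suff : \forall T \near +oo%R, K `<=` [set z | O (periodize T z)].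
  by apply: filterS => T KT _ [z Kz <-]; exact: KT.
(* Compactness turns uniformity in T over [K] into a joint condition near (z, +oo) for each z in
   [K]. *)
move/compact_near_coveringP : cK; apply => z Kz.
have Oz : nbhs (f z) O by apply: open_nbhs_nbhs; split => //; apply: fKO; exists z.
have f_pexp := cvg_comp _ _ (@pexp_mx_cvg z) (cf z).
have := cvgB (cvgD (@coord_cvg z ord0 i0) f_pexp) (@pexp_coord_cvg z ord0 i0).
(* In the limit the two coordinate terms cancel and leave [f z]. *)
rewrite [_ + f z]addrC addrK => H.
exact: H Oz.
Qed.

End Periodization.

Theorem proposition1p5 (R : realType) (k : nat) (hk : (1 <= k)%N) :
  dense [set f : diag_holo R k | periodic_point f].
Proof.
(* The topology is induced, so [O] is the trace of an open set [U] of the full function space, where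
   the convergence was proved. *)
move=> O [f Of] [U oU UO].
have [hf _] : diag_holo_set (set_val f) by exact: set_valP.
have cf : continuous (set_val f).
  by move=> z; exact: differentiable_continuous.
have Uf : U (set_val f) by rewrite -UO in Of.
(* Since k >= 1, the first coordinate exists and serves as z_0. *)
have UT := periodize_cvg (Ordinal hk) cf (open_nbhs_nbhs (conj oU Uf)).
near (+oo%R : set_system R) => T.
have T0 : 0 < T by near: T; apply: nbhs_pinfty_gt; exact: num_real.
have UfT : U (periodize (Ordinal hk) (set_val f) T) by near: T; exact: UT.
exists (SigSub (periodize_diag_holo (Ordinal hk) T (set_valP f))).
split; first by rewrite -UO.
exists T => //; apply/val_inj => /=; apply: translate_periodize.
by rewrite gt_eqF.
Unshelve. all: by end_near. Qed.
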